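(* For every integer $m\ge 1$, as formal power series in $q$, $$\sum_{n\ge 0}p_{\mathrm{pg}}(n,2m)q^n=\frac{q^{2m}}{(1-q^{2m})^{m}(1-q^{m})}.$$ Consequently, for every integer $n\ge 0$, $$p_{\mathrm{pg}}(n,2m)=\begin{cases}\displaystyle\binom{\left\lfloor\frac{n}{2m}\right\rfloor+m-1}{m}, & m\mid n \text{ and } n\ge 2m,\\[2mm] 0, & \text{otherwise}.\end{cases}$$
   Context: A partition of $n$ into exactly $r$ parts is a sequence $\lambda=(\lambda_1,\dots,\lambda_r)$ of positive integers with $\lambda_1\le\cdots\le\lambda_r$ and $\lambda_1+\cdots+\lambda_r=n$. It is a palindromic-gap partition if $\lambda_{i+1}-\lambda_i=\lambda_{r-i+1}-\lambda_{r-i}$ for all $1\le i\le r-1$. $p_{\mathrm{pg}}(n,r)$ denotes the number of palindromic-gap partitions of $n$ into exactly $r$ parts. *)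

(* Defs.v *)
From HB Require Import structures.
From mathcomp Require Import all_boot all_order all_algebra.
From mathcomp Require Import boolp.

Set Implicit Arguments.
Unset Strict Implicit.
Unset Printing Implicit Defensive.

Import GRing.Theory.

Local Open Scope ring_scope.

(* Formal power series R[[q]], with the Cauchy product. A series f is a unit
   iff its constant coefficient is; the coefficients b_n of its inverse are
   then determined by sum_(j <= n) f_(n-j) b_j = (n == 0). *)

Record fps (R : Type) := Fps { fcoef : nat -> R }.

HB.instance Definition _ (R : Type) := gen_eqMixin (fps R).
HB.instance Definition _ (R : Type) := gen_choiceMixin (fps R).

Lemma fpsP (R : Type) (f g : fps R) : (forall n, fcoef f n = fcoef g n) -> f = g.
Proof. by case: f => f; case: g => g /= /funext ->. Qed.

Section ZmodFps.
Variable R : zmodType.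
Implicit Types f g : fps R.

Definition fps0 : fps R := Fps (fun=> 0).
Definition fps_opp f : fps R := Fps (fun n => - fcoef f n).
Definition fps_add f g : fps R := Fps (fun n => fcoef f n + fcoef g n).

Lemma fps_addA : associative fps_add.
Proof. by move=> f g h; apply: fpsP => n /=; rewrite addrA. Qed.
Lemma fps_addC : commutative fps_add.
Proof. by move=> f g; apply: fpsP => n /=; rewrite addrC. Qed.
Lemma fps_add0 : left_id fps0 fps_add.
Proof. by move=> f; apply: fpsP => n /=; rewrite add0r. Qed.
Lemma fps_addN : left_inverse fps0 fps_opp fps_add.
Proof. by move=> f; apply: fpsP => n /=; rewrite addNr. Qed.

HB.instance Definition _ :=
  GRing.isZmodule.Build (fps R) fps_addA fps_addC fps_add0 fps_addN.

End ZmodFps.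

Section RingFps.
Variable R : comNzRingType.
Implicit Types f g : fps R.

Definition fps1 : fps R := Fps (fun n => (n == 0%N)%:R).
Definition fps_mul f g : fps R :=
  Fps (fun n => \sum_(j < n.+1) fcoef f j * fcoef g (n - j)).
Definition fpsX : fps R := Fps (fun n => (n == 1%N)%:R).

Let trunc n f : {poly R} := \poly_(i < n.+1) fcoef f i.

Let coef_trunc n f i : (i <= n)%N -> (trunc n f)`_i = fcoef f i.
Proof. by move=> le_in; rewrite coef_poly ltnS le_in. Qed.

Let coef_truncM n f g i :
  (i <= n)%N -> fcoef (fps_mul f g) i = (trunc n f * trunc n g)`_i.
Proof.
move=> le_in; rewrite coefM; apply: eq_bigr => j _.
rewrite !coef_trunc ?(leq_trans (leq_subr _ _)) //.
by apply: leq_trans le_in; rewrite -ltnS.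
Qed.

Lemma fps_mulA : associative fps_mul.
Proof.
move=> f g h; apply: fpsP => n.
transitivity (trunc n f * (trunc n g * trunc n h))`_n.
  rewrite coefM; apply: eq_bigr => j _.
  by rewrite (coef_truncM (n := n)) ?leq_subr // coef_trunc // -ltnS.
rewrite mulrA coefM; apply: eq_bigr => j _.
by rewrite (coef_truncM (n := n)) ?coef_trunc ?leq_subr // -ltnS.
Qed.

Lemma fps_mulC : commutative fps_mul.
Proof.
move=> f g; apply: fpsP => n.
by rewrite !(coef_truncM (n := n)) // mulrC.
Qed.

Lemma fps_mul1 : left_id fps1 fps_mul.
Proof.
move=> f; apply: fpsP => n /=.
rewrite big_ord_recl /= mul1r subn0 big1 ?addr0 // => j _.
by rewrite mul0r.
Qed.

Lemma fps_mulDl : left_distributive fps_mul (@fps_add R).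
Proof.
move=> f g h; apply: fpsP => n /=.
by rewrite -big_split /=; apply: eq_bigr => j _; rewrite mulrDl.
Qed.

Lemma fps1_neq0 : fps1 != 0 :> fps R.
Proof.
by apply/eqP => /(congr1 (fun f => fcoef f 0%N)) /= /eqP; rewrite oner_eq0.
Qed.

HB.instance Definition _ := GRing.Zmodule_isComNzRing.Build (fps R)
  fps_mulA fps_mulC fps_mul1 fps_mulDl fps1_neq0.

Lemma fcoefD f g n : fcoef (f + g) n = fcoef f n + fcoef g n.
Proof. by []. Qed.
Lemma fcoefN f n : fcoef (- f) n = - fcoef f n.
Proof. by []. Qed.
Lemma fcoef1 n : fcoef (1 : fps R) n = (n == 0%N)%:R.
Proof. by []. Qed.
Lemma fcoefM f g n :
  fcoef (f * g) n = \sum_(j < n.+1) fcoef f j * fcoef g (n - j).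
Proof. by []. Qed.

Lemma fcoefXn k n : fcoef (fpsX ^+ k) n = (n == k)%:R.
Proof.
elim: k n => [|k IHk] n; first by rewrite expr0.
rewrite exprS fcoefM; case: n => [|n].
  by rewrite big_ord_recl big_ord0 /= mul0r addr0.
rewrite big_ord_recl /= mul0r add0r big_ord_recl /= mul1r subn1 /= IHk eqSS.
by rewrite big1 ?addr0 // => j _; rewrite mul0r.
Qed.

End RingFps.

Section UnitFps.
Variable R : comUnitRingType.
Implicit Types f g : fps R.

Definition fps_unit : {pred fps R} := fun f => fcoef f 0%N \is a GRing.unit.

Fixpoint fps_inv_seq f n : seq R :=
  if n is k.+1 then
    let s := fps_inv_seq f k in
    rcons s ((fcoef f 0%N)^-1
             * ((k == 0%N)%:R - \sum_(j < k) fcoef f (k - j) * s`_j))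
  else [::].

Definition fps_inv f : fps R :=
  if f \in fps_unit then Fps (fun n => (fps_inv_seq f n.+1)`_n) else f.

Let size_inv_seq f n : size (fps_inv_seq f n) = n.
Proof. by elim: n => //= n IHn; rewrite size_rcons IHn. Qed.

Let nth_inv_seq f n j :
  (j < n)%N -> (fps_inv_seq f n)`_j = (fps_inv_seq f j.+1)`_j.
Proof.
elim: n => // n IHn; rewrite ltnS leq_eqVlt => /predU1P[-> //|lt_jn].
by rewrite [LHS]nth_rcons size_inv_seq lt_jn IHn.
Qed.

Lemma fcoef_inv f n : f \in fps_unit ->
  fcoef (fps_inv f) n = (fcoef f 0%N)^-1
    * ((n == 0%N)%:R - \sum_(j < n) fcoef f (n - j) * fcoef (fps_inv f) j).
Proof.
move=> Uf; rewrite /fps_inv Uf {1}/fcoef [LHS]nth_rcons size_inv_seq ltnn eqxx.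
by under eq_bigr => j _ do rewrite nth_inv_seq //.
Qed.

Lemma fps_mulVf : {in fps_unit, left_inverse 1 fps_inv *%R}.
Proof.
move=> f Uf; apply: fpsP => n; rewrite fcoefM fcoef1 big_ord_recr /= subnn.
rewrite fcoef_inv // mulrAC mulVr // mul1r.
under eq_bigr => j _ do rewrite mulrC.
by rewrite addrC subrK.
Qed.

Lemma fps_unitP f g : g * f = 1 -> fps_unit f.
Proof.
move=> /(congr1 (fun h => fcoef h 0%N)).
rewrite fcoefM big_ord_recl big_ord0 addr0 subn0 fcoef1 => gf1.
by rewrite /fps_unit; apply/unitrPr; exists (fcoef g 0%N); rewrite mulrC.
Qed.

Lemma fps_inv_out : {in [predC fps_unit], fps_inv =1 id}.
Proof. by move=> f; rewrite inE /fps_inv => /negPf ->. Qed.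

HB.instance Definition _ := GRing.ComNzRing_hasMulInverse.Build (fps R)
  fps_mulVf fps_unitP fps_inv_out.

Lemma fps_unitE f :
  (f \is a GRing.unit) = (fcoef f 0%N \is a GRing.unit).
Proof. by []. Qed.

Lemma fps_1BXn_unit k : (0 < k)%N -> 1 - fpsX R ^+ k \is a GRing.unit.
Proof.
by case: k => // k _; rewrite fps_unitE fcoefD fcoefN fcoef1 fcoefXn subr0 unitr1.
Qed.

End UnitFps.

Local Open Scope nat_scope.

Definition is_partition (n r : nat) (s : seq nat) : bool :=
  [&& size s == r, all (ltn 0) s, sorted leq s & sumn s == n].

(* 1-based access: part s i is the part lambda_i of s = (lambda_1, ...). *)
Definition part (s : seq nat) (i : nat) : nat := nth 0 s i.-1.

(* On a sorted s the truncated differences below are the actual gaps. *)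
Definition palindromic_gap (r : nat) (s : seq nat) : bool :=
  all (fun i => part s i.+1 - part s i == part s (r - i + 1) - part s (r - i))
      (iota 1 r.-1).

(* The parts of a partition of n are at most n (see part_bound), so the
   partitions into r parts are found among the r-tuples over 'I_n.+1. *)
Definition p_pg (n r : nat) : nat :=
  #|[set t : r.-tuple 'I_n.+1 | is_partition n r (map val t)
                                && palindromic_gap r (map val t)]|.

Lemma part_bound n r s x : is_partition n r s -> x \in s -> x <= n.
Proof.
case/and4P=> _ _ _ /eqP <-; elim: s => //= y s IHs.
rewrite inE => /predU1P[->|/IHs le_xs]; first exact: leq_addr.
exact: leq_trans le_xs (leq_addl _ _).
Qed.

Definition pg_series (r : nat) : fps int := Fps (fun n => Posz (p_pg n r)).

(* Main.v *)
Require Import Defs.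
From HB Require Import structures.
From mathcomp Require Import all_boot all_order all_algebra.
From mathcomp Require Import zify ring.

(** Palindromic gaps mean that the partition is symmetric: pairing the i-th
    smallest part with the i-th largest one always gives the same sum S, since
    passing from one pair to the next adds a gap to the smaller part and
    removes the equal, opposite gap from the larger part
    ([palindromic_gapP]). With 2m parts there are m such pairs, so n = m S; in
    particular m divides n and S = n / m. The partition is then determined by
    its lower half u, the upper half being the reflection x |-> S - x of u, and
    the only constraints on u are that it is nondecreasing, positive, and that
    its last part does not exceed the reflected one, that is, all its parts
    are at most S / 2 ([pg_partitionP]). So the partitions are counted by the
    multisets of size m in {1, ..., k} with k = floor (n / 2m), and there are
    'C(k + m - 1, m) of them ([card_pg_partitions]).

    The generating function follows from this count. Written as n = m S, the
    count depends only on floor (S / 2), so every coefficient occurs twice, for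
    S = 2k and for S = 2k + 1. By the negative binomial expansion
    ([binomial_fpsE]) the series is therefore
      q^2m (1 + q^m) / (1 - q^2m)^(m+1)      ([pg_seriesE]),
    and 1 - q^2m = (1 - q^m) (1 + q^m) turns it into the announced quotient. *)

Set Implicit Arguments.
Unset Strict Implicit.
Unset Printing Implicit Defensive.

(** * Symmetric sequences and their lower halves *)

(** Comparing the sums of two consecutive pairs, nth i + nth (r - 1 - i) and
    nth (i + 1) + nth (r - 2 - i), is comparing two opposite gaps. Sortedness
    is what makes the truncated differences faithful. *)
Lemma palindromic_gapP r s : size s = r -> sorted leq s ->
  palindromic_gap r s <->
  exists S, forall i, i < r -> nth 0 s i + nth 0 s (r - i.+1) = S.
Proof.
move=> sz_s s_sorted.
have nondecr i : i.+1 < r -> nth 0 s i <= nth 0 s i.+1.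
  by move=> lt_ir; apply/(sortedP 0 s_sorted); rewrite sz_s.
split=> [/allP gap | [S pairS]].
  exists (nth 0 s 0 + nth 0 s r.-1); elim=> [|i IHi] lt_ir.
    by rewrite subn1.
  have /gap/eqP : i.+1 \in iota 1 r.-1 by rewrite mem_iota; lia.
  rewrite /part addn1 /= => gap_i.
  have := nondecr i lt_ir; have := nondecr (r - i.+2).
  have := IHi (ltnW lt_ir); have := gap_i.
  have -> : (r - i.+1).-1 = r - i.+2 by lia.
  have -> : (r - i.+2).+1 = r - i.+1 by lia.
  lia.
apply/allP=> -[|i]; rewrite mem_iota // => /andP[_ lt_ir].
have {}lt_ir : i.+1 < r by lia.
rewrite /part addn1 /=; apply/eqP.
have := pairS i (ltnW lt_ir); have := pairS i.+1 lt_ir.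
have := nondecr i lt_ir; have := nondecr (r - i.+2).
have -> : (r - i.+1).-1 = r - i.+2 by lia.
have -> : (r - i.+2).+1 = r - i.+1 by lia.
lia.
Qed.

Definition mirror S (u : seq nat) := u ++ rev [seq S - x | x <- u].

Lemma size_mirror S u : size (mirror S u) = 2 * size u.
Proof. by rewrite size_cat size_rev size_map mul2n addnn. Qed.

Lemma sumn_mirror S u : all (geq S) u -> sumn (mirror S u) = size u * S.
Proof.
rewrite sumn_cat sumn_rev; elim: u => //= x u IHu /andP[le_xS /IHu].
by rewrite mulSn => <-; rewrite addnACA subnKC.
Qed.

Lemma mirrorP S m s : size s = 2 * m ->
    (forall i, i < 2 * m -> nth 0 s i + nth 0 s (2 * m - i.+1) = S) ->
  s = mirror S (take m s).
Proof.
move=> sz_s pairS.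
have sz_take : size (take m s) = m by rewrite size_takel // sz_s; lia.
apply: (@eq_from_nth _ 0) => [|i]; rewrite ?size_mirror sz_s ?sz_take //.
move=> lt_i; rewrite nth_cat sz_take; case: ltnP => [lt_im|le_mi].
  by rewrite nth_take.
rewrite nth_rev size_map sz_take; last by lia.
rewrite (nth_map 0) ?sz_take ?nth_take; try lia.
have := pairS i lt_i; have -> : m - (i - m).+1 = 2 * m - i.+1 by lia.
lia.
Qed.

(** The statement is invariant under i |-> 2 (size u) - 1 - i, which reduces it
    to indices in the lower half. *)
Lemma mirror_pair S u i : all (geq S) u -> i < 2 * size u ->
  nth 0 (mirror S u) i + nth 0 (mirror S u) (2 * size u - i.+1) = S.
Proof.
move=> /(all_nthP 0) leS.
wlog lt_iu : i / i < size u => [hw lt_i | lt_i].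
  case: (ltnP i (size u)) => [/hw->|le_ui] //.
  rewrite addnC -[RHS](hw (2 * size u - i.+1)); try lia.
  by congr (_ + nth _ _ _); lia.
rewrite !nth_cat lt_iu ifF; last by lia.
rewrite nth_rev size_map; last by lia.
have -> : size u - (2 * size u - i.+1 - size u).+1 = i by lia.
by rewrite (nth_map 0) // subnKC //; apply: leS.
Qed.

(** The two halves meet in the right order because x <= S / 2 and z <= S / 2
    give x <= S - z; this is where the bound S / 2 of the count comes from. *)
Lemma mirror_sorted S u : sorted leq u -> all (geq (S %/ 2)) u ->
  sorted leq (mirror S u).
Proof.
move=> u_sorted /allP le_half.
rewrite sorted_pairwise; last exact: leq_trans.
rewrite pairwise_cat -!sorted_pairwise; try exact: leq_trans.
rewrite u_sorted rev_sorted; apply/and3P; split=> //.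
  apply/allrelP=> x y xu; rewrite mem_rev => /mapP[z zu ->].
  by have /= := le_half x xu; have /= := le_half z zu; lia.
apply: (homo_sorted (e := leq)) u_sorted => x y /=; lia.
Qed.

(** * Counting palindromic-gap partitions *)

(** The common sum S of the pairs is forced to be n / m by the total, which is
    why it does not appear as a parameter. The bound on u is
    floor (S / 2) = floor (n / 2m). *)
Lemma pg_partitionP m n s : 0 < m ->
  is_partition n (2 * m) s && palindromic_gap (2 * m) s <->
  m %| n /\ exists u, [/\ size u = m, sorted leq u,
    all (fun x => 0 < x <= n %/ (2 * m)) u & s = mirror (n %/ m) u].
Proof.
move=> m_gt0; rewrite mulnC divnMA mulnC; split.
  case/andP=> /and4P[/eqP sz_s s_gt0 s_sorted /eqP sum_s].
  case/(palindromic_gapP sz_s s_sorted) => S pairS.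
  have s_mirror := mirrorP sz_s pairS.
  have sz_take : size (take m s) = m by rewrite size_takel // sz_s; lia.
  have bounds : all (fun x => 0 < x <= S %/ 2) (take m s).
    apply/(all_nthP 0) => i; rewrite sz_take => lt_im; rewrite nth_take //.
    have lt_i : i < 2 * m by lia.
    apply/andP; split; first by apply: (all_nthP 0 s_gt0); rewrite sz_s.
    have : nth 0 s i <= nth 0 s (2 * m - i.+1).
      by apply: (sorted_leq_nth leq_trans leqnn 0 s_sorted); rewrite ?inE; lia.
    have := pairS i lt_i; lia.
  have nE : n = m * S.
    rewrite -sum_s s_mirror sumn_mirror ?sz_take //.
    by apply: sub_all bounds => x /=; lia.
  rewrite nE dvdn_mulr // mulKn //; split=> //.
  by exists (take m s); split=> //; apply: take_sorted.
case=> m_dvd_n [u [sz_u u_sorted bounds ->]].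
set S := n %/ m in bounds *.
have leS : all (geq S) u by apply: sub_all bounds => x /=; lia.
have mir_sorted : sorted leq (mirror S u).
  by apply: mirror_sorted => //; apply: sub_all bounds => x /andP[].
have sz_mir : size (mirror S u) = 2 * m by rewrite size_mirror sz_u.
apply/andP; split; last first.
  apply/palindromic_gapP => //; exists S => i lt_i.
  by rewrite -sz_u; apply: mirror_pair; rewrite ?sz_u.
apply/and4P; split=> //; first by rewrite sz_mir.
  rewrite all_cat all_rev all_map; apply/andP; split.
    by apply: sub_all bounds => x /andP[].
  by apply: sub_all bounds => x /=; lia.
by rewrite sumn_mirror // sz_u mulnC divnK.
Qed.

(** Reflecting the lower half is a bijection from the nondecreasing m-tuples
    over {1, ..., k}, with k = n %/ (2 * m), onto the palindromic-gap
    partitions of n into 2m parts. *)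
Lemma card_pg_partitions m n : 0 < m -> m %| n -> 0 < n %/ (2 * m) ->
  p_pg n (2 * m) = 'C(n %/ (2 * m) + m - 1, m).
Proof.
move=> m_gt0 m_dvd_n; case def_k: (n %/ (2 * m)) => [//|k] _.
rewrite addSn subn1 /= addnC -card_sorted_tuples /p_pg.
(* Ordinals range over {0, ..., k}, hence the shift by one to positive parts. *)
pose lft (t : m.-tuple 'I_k.+1) := [seq (val x).+1 | x <- t].
have sz_lft t : size (lft t) = m by rewrite size_map size_tuple.
pose f t :=
  [tuple inord (n':=n) (nth 0 (mirror (n %/ m) (lft t)) i) | i < 2 * m].
have k_le : k.+1 <= n %/ m.
  by rewrite -def_k mulnC divnMA leq_div.
have val_f t : map val (f t) = mirror (n %/ m) (lft t).
  have sz_mir : size (mirror (n %/ m) (lft t)) = 2 * m.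
    by rewrite size_mirror sz_lft.
  apply: (@eq_from_nth _ 0) => [|i]; rewrite size_map size_tuple ?sz_mir //.
  move=> lt_i; rewrite (nth_map ord0) ?size_tuple //.
  rewrite -[i]/(val (Ordinal lt_i)) -tnth_nth tnth_mktuple /= inordK // ltnS.
  apply: leq_trans (leq_div n m).
  have /(mem_nth 0) : i < size (mirror (n %/ m) (lft t)) by rewrite sz_mir.
  (* Every part is at most n %/ m <= n, so [inord] does not truncate it. *)
  rewrite mem_cat mem_rev => /orP[] /mapP[x x_in ->]; last exact: leq_subr.
  exact: leq_trans (ltn_ord x) k_le.
have f_inj : injective f.
  move=> t t' eq_f.
  have: take m (map val (f t)) = take m (map val (f t')) by rewrite eq_f.
  rewrite !val_f !take_size_cat ?sz_lft // => eq_lft.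
  apply: val_inj; apply: (inj_map (f := fun x : 'I_k.+1 => (val x).+1)) => //.
  by move=> x y [/val_inj].
rewrite -(card_imset _ f_inj); apply: eq_card => t; rewrite inE.
apply/idP/imsetP => [/(pg_partitionP _ _ m_gt0) | [t' + ->]]; last first.
  rewrite inE val_f => t'_sorted; apply/pg_partitionP => //; split=> //.
  exists (lft t'); split=> //; last first.
    by rewrite all_map def_k; apply/allP=> x _ /=.
  by rewrite /lft (map_comp S val) sorted_map.
case=> _ [u [sz_u u_sorted bounds t_mir]]; rewrite def_k in bounds.
pose t' := [tuple inord (n':=k) (nth 0 u i).-1 | i < m].
have lft_t' : lft t' = u.
  apply: (@eq_from_nth _ 0) => [|i]; rewrite sz_lft ?sz_u // => lt_i.
  rewrite (nth_map ord0) ?size_tuple //.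
  rewrite -[i in LHS]/(val (Ordinal lt_i)) -tnth_nth tnth_mktuple /=.
  have /(all_nthP 0)/(_ i) := bounds; rewrite sz_u => /(_ lt_i) bnd.
  by rewrite inordK; lia.
exists t'; last by apply/val_inj/(inj_map val_inj); rewrite val_f lft_t'.
rewrite inE; move: u_sorted; rewrite -lft_t' /lft (map_comp S val).
by rewrite sorted_map.
Qed.

(** When n < 2m the lower half would need its m > 0 entries in the empty range
    1, ..., 0. *)
Lemma p_pgE m n : 0 < m ->
  p_pg n (2 * m) =
    if (m %| n) && (2 * m <= n) then 'C(n %/ (2 * m) + m - 1, m) else 0.
Proof.
move=> m_gt0; case: ifP => [/andP[m_dvd_n le_n]|].
  by apply: card_pg_partitions => //; rewrite divn_gt0 //; lia.
move/negbT; rewrite negb_and => no_pg; apply/eqP; rewrite cards_eq0; apply/eqP.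
apply/setP=> t; rewrite !inE; apply/negbTE/negP.
case/(pg_partitionP _ _ m_gt0) => m_dvd_n [[|x u] [/= sz_u _ bounds _]].
  by rewrite -sz_u in m_gt0.
have := no_pg; rewrite m_dvd_n -ltnNge /= => /divn_small k0.
by move: bounds; rewrite k0; lia.
Qed.

(** * The generating function *)

Import GRing.Theory.
Local Open Scope ring_scope.

Lemma fcoefXnM (R : comNzRingType) k (f : fps R) n :
  fcoef (fpsX R ^+ k * f) n = if (k <= n)%N then fcoef f (n - k) else 0.
Proof.
rewrite fcoefM; under eq_bigr do rewrite fcoefXn.
case: leqP => [le_kn|lt_nk].
  rewrite (bigD1 (inord k)) //= inordK // eqxx mul1r big1 ?addr0 // => i.
  rewrite -val_eqE /= inordK // => /negPf->; exact: mul0r.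
apply: big1 => i _; rewrite ltn_eqF ?mul0r //.
exact: leq_trans (ltn_ord i) lt_nk.
Qed.

(** The expansion of 1 / (1 - q^d)^j: the coefficient of q^(d k) is the number
    of multisets of size k in j elements. It is written with lower index k
    rather than j - 1 so that it remains correct at j = 0, where
    'C(k - 1, k), with truncated difference, is 1 for k = 0 and 0 for k > 0. *)
Definition binomial_fps (R : comNzRingType) d j : fps R :=
  Fps (fun n => if (d %| n)%N then 'C(n %/ d + j - 1, n %/ d)%:R else 0).

Lemma binomial_fps0 (R : comNzRingType) d : (0 < d)%N -> binomial_fps R d 0 = 1.
Proof.
move=> d_gt0; apply: fpsP => n; rewrite fcoef1 /=.
case: ifP => [/dvdnP[[|k] ->]|]; first by rewrite div0n bin0.
  by rewrite mulnK // addn0 subn1 bin_small // muln_eq0 (gtn_eqF d_gt0).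
by case: n => //; rewrite dvdn0.
Qed.

(** On the coefficients of the powers of q^d this is Pascal's rule
    'C(k + j + 1, k + 1) - 'C(k + j, k) = 'C(k + j, k + 1). *)
Lemma binomial_fpsS (R : comNzRingType) d j : (0 < d)%N ->
  (1 - fpsX R ^+ d) * binomial_fps R d j.+1 = binomial_fps R d j.
Proof.
move=> d_gt0; apply: fpsP => n.
rewrite mulrBl mul1r fcoefD fcoefN fcoefXnM /=.
case: (leqP d n) => [/subnKC <-|lt_nd]; last first.
  rewrite subr0; case: ifP => // /dvdnP[[|k] def_n]; last by lia.
  by rewrite def_n mul0n div0n !bin0.
rewrite addKn dvdn_addr // divnDl // divnn d_gt0.
case: ifP => _; last exact: subr0.
set k := (_ %/ d)%N; rewrite !addnS !subn1 /= !addSn binS natrD /=.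
by rewrite addnC addrK.
Qed.

Lemma binomial_fpsE (R : comNzRingType) d j : (0 < d)%N ->
  (1 - fpsX R ^+ d) ^+ j * binomial_fps R d j = 1.
Proof.
move=> d_gt0; elim: j => [|j IHj]; first by rewrite mul1r binomial_fps0.
by rewrite exprSr -mulrA binomial_fpsS.
Qed.

(** After the shift by q^2m, a nonzero coefficient sits at n = k m and depends
    only on floor (k / 2). The factor 1 + q^m splits these according to the
    parity of k: even k come from the summand 1, odd k from q^m. *)
Lemma pg_seriesE m : (0 < m)%N ->
  pg_series (2 * m) =
  fpsX int ^+ (2 * m) * ((1 + fpsX int ^+ m) * binomial_fps int (2 * m) m.+1).
Proof.
move=> m_gt0; apply: fpsP => n; rewrite fcoefXnM [LHS]/= p_pgE // andbC.
case: (leqP (2 * m) n) => [/subnKC <-|//]; rewrite addKn.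
move: (n - 2 * m)%N => {}n.
rewrite mulrDl mul1r fcoefD fcoefXnM /= dvdn_addr ?dvdn_mull //.
rewrite divnDl // divnn muln_gt0 m_gt0 /= add1n addSn subn1 /=.
rewrite !addnS !subn1 /=.
have binE k : 'C(k + m, m) = 'C(k + m, k).
  by rewrite -[RHS]bin_sub ?leq_addr // addKn.
case: ifP => [/dvdnP[k ->] | m_ndvd_n]; last first.
  have ndvd_2m a : (m %| a)%N = false -> (2 * m %| a)%N = false.
    move=> m_ndvd_a; apply/negP=> /(dvdn_trans (dvdn_mull 2 (dvdnn m))).
    by rewrite m_ndvd_a.
  rewrite ndvd_2m // add0r; case: leqP => // le_mn; rewrite ndvd_2m //.
  by rewrite dvdn_subl.
rewrite dvdn_pmul2r // divnMr //.
have -> : (m <= k * m)%N = (0 < k)%N by rewrite -{1}(mul1n m) leq_pmul2r.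
have -> : (k * m - m = (k - 1) * m)%N by rewrite mulnBl mul1n.
rewrite dvdn_pmul2r // divnMr // binE.
case: (boolP (2 %| k)%N) => [k_even|k_odd].
  rewrite [X in _ + X](_ : _ = 0) ?addr0 ?natz //.
  by case: ltnP => // k_gt0; rewrite ifF //; lia.
have [-> -> ->] : [/\ (0 < k)%N, (2 %| k - 1)%N & k %/ 2 = (k - 1) %/ 2]%N.
  by split; lia.
by rewrite add0r natz.
Qed.

Theorem corollary6 (m : nat) (hm : (1 <= m)%N) :
  (let q := fpsX int in
   pg_series (2 * m)
     = q ^+ (2 * m) / ((1 - q ^+ (2 * m)) ^+ m * (1 - q ^+ m)))%R
  /\
  (forall n : nat,
     p_pg n (2 * m) =
       if (m %| n) && (2 * m <= n)
       then 'C(n %/ (2 * m) + m - 1, m)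
       else 0)%N.
Proof.
split; last by move=> n; apply: p_pgE.
move=> q.
have den_unit : (1 - q ^+ (2 * m)) ^+ m * (1 - q ^+ m) \is a GRing.unit.
  by rewrite unitrM unitrX fps_1BXn_unit // muln_gt0.
apply: (mulIr den_unit); rewrite divrK // pg_seriesE // -/q.
have sqE : 1 - q ^+ (2 * m) = (1 - q ^+ m) * (1 + q ^+ m).
  by rewrite mulnC exprM -subr_sqr expr1n.
have d_gt0 : (0 < 2 * m)%N by rewrite muln_gt0.
have := binomial_fpsE int m.+1 d_gt0; rewrite exprSr -/q => invE.
rewrite -[RHS]mulr1 -[X in _ = _ * X]invE [X in _ = _ * (_ * X * _)]sqE.
ring.
Qed.
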